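(* For a non-convex objective function $F(\cdot)$, where $F^*=\min_{\mathbf w}F(\mathbf w)$, the following ergodic convergence result holds for $K$-async SGD with fixed learning rate $\eta$: $$\frac1J\sum_{j=0}^{J-1}\mathbb{E}\big[\|\nabla F(\mathbf w_j)\|_2^2\big]\le\frac{2(F(\mathbf w_0)-F^* )}{J\eta\gamma'}+\frac{L\eta\sigma^2}{Km\gamma'},$$ where $\gamma'=1-\gamma+\frac{p_0}{2}$, and $L,\sigma^2,m,\gamma,p_0$ are as specified in the context.
   Context: $F(\mathbf w)=\frac1N\sum_{n=1}^N f(\mathbf w,\xi_n)$ is the empirical risk over $N$ training samples. For a mini-batch $\xi_{l,j}$ of $m$ samples, $g(\mathbf w,\xi_{l,j})=\frac1m\sum_{\xi\in\xi_{l,j}}\nabla f(\mathbf w,\xi)$. $K$-async SGD with $P$ workers is the recursion $$\mathbf w_{j+1}=\mathbf w_j-\frac{\eta}{K}\sum_{l=1}^K g(\mathbf w_{\tau(l,j)},\xi_{l,j}),$$ started from a known $\mathbf w_0$. Each update uses the gradients of the $K$ workers (out of $P$) that finish first, indexed $l=1,\dots,K$, the others not being cancelled; $\xi_{l,j}$ is the mini-batch used by the $l$-th of these workers at iteration $j$, and $\tau(l,j)\le j$ is the iteration index at which that worker last read the parameter, so gradients may be stale. $J$ is the number of iterations. Standing assumptions: 1. $F$ is $L$-smooth: $\|\nabla F(\mathbf w)-\nabla F(\widetilde{\mathbf w})\|_2\le L\|\mathbf w-\widetilde{\mathbf w}\|_2$ for all $\mathbf w,\widetilde{\mathbf w}$.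 2. Unbiasedness: for a mini-batch $\xi_j$ used at iteration $j$, $\mathbb{E}_{\xi_j\mid\mathbf w_k}[g(\mathbf w_k,\xi_j)]=\nabla F(\mathbf w_k)$ for all $k\le j$ (such $\mathbf w_k$ being the value of the parameter before the data $\xi_j$ was accessed, and assumed independent of $\xi_j$). 3. Bounded variance: $\mathbb{E}_{\xi_j\mid\mathbf w_k}[\|g(\mathbf w_k,\xi_j)-\nabla F(\mathbf w_k)\|_2^2]\le\frac{\sigma^2}{m}+\frac{M_G}{m}\|\nabla F(\mathbf w_k)\|_2^2$ for all $k\le j$. 4. Staleness bound: for some $\gamma\le1$, $\mathbb{E}[\|\nabla F(\mathbf w_j)-\nabla F(\mathbf w_{\tau(l,j)})\|_2^2]\le\gamma\,\mathbb{E}[\|\nabla F(\mathbf w_j)\|_2^2]$. $p_0$ is a lower bound on the conditional probability that $\tau(l,j)=j$, given all the past delays and parameters.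
   Formalization: Added, as the claim fails otherwise: the learning rate satisfies 0<η and 2Lη(M_G/(Km)+1)≤1; γ'>0; and at each update the K workers' mini-batches are mutually independent and jointly independent of the parameters and delays up to that iteration. *)

(* Defs.v *)
From mathcomp Require Import all_boot all_order all_algebra.
From mathcomp Require Import all_classical all_reals all_analysis.

Set Implicit Arguments.
Unset Strict Implicit.
Unset Printing Implicit Defensive.

Import Order.TTheory GRing.Theory Num.Theory.
Import numFieldNormedType.Exports.

Local Open Scope classical_set_scope.
Local Open Scope ring_scope.

(* The library norm on 'rV[R]_d is the max norm; this is the Euclidean one. *)
Definition l2norm {R : realType} {d : nat} (v : 'rV[R]_d) : R :=
  Num.sqrt (\sum_(i < d) v ord0 i ^+ 2).

(* The vector of partial derivatives; it is only used for functions that are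
   (sums of) everywhere differentiable functions. *)
Definition grad {R : realType} {d : nat} (h : 'rV[R]_d -> R) (w : 'rV[R]_d) :
  'rV[R]_d := \row_(i < d) 'D_(delta_mx ord0 i) (h : _ -> R^o) w.

(* [f n w] is the loss at the parameter [w] on the n-th training sample. *)
Definition empirical_risk {R : realType} {d N : nat}
    (f : 'I_N -> 'rV[R]_d -> R) (w : 'rV[R]_d) : R :=
  N%:R^-1 * \sum_(n < N) f n w.

(* A mini-batch is a tuple of m indices of training samples, possibly with
   repetitions. *)
Definition batch_grad {R : realType} {d N m : nat}
    (f : 'I_N -> 'rV[R]_d -> R) (w : 'rV[R]_d) (b : m.-tuple 'I_N) : 'rV[R]_d :=
  m%:R^-1 *: \sum_(i < m) grad (f (tnth b i)) w.

Definition smooth {R : realType} {d : nat} (L : R) (F : 'rV[R]_d -> R) : Prop :=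
  (forall w, differentiable (F : _ -> R^o) w) /\
  forall w w', l2norm (grad F w - grad F w') <= L * l2norm (w - w').

Definition is_minimum {T : Type} {R : realType} (F : T -> R) (c : R) : Prop :=
  (exists w, F w = c) /\ forall w, c <= F w.

(* [S j l] is the l-th of the K workers whose gradients are used in update j.
   Everybody reads the parameter of index 0 at the start; a worker whose
   gradient is used in update j then reads the parameter of index j + 1; the
   other workers carry on with what they have read before.  [last_read S p j]
   is the index of the last parameter read by worker p when update j occurs. *)
Fixpoint last_read {K P : nat} (S : nat -> 'I_K -> 'I_P) (p : 'I_P) (j : nat) :
    nat :=
  if j is j'.+1 then
    if [exists l, S j' l == p] then j else last_read S p j'
  else 0%N.

Definition read_index {Omega : Type} {K P : nat}
    (S : nat -> 'I_K -> Omega -> 'I_P) (l : 'I_K) (j : nat) (o : Omega) : nat :=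
  last_read (fun i k => S i k o) (S j l o) j.

(* Measurability of X when T is countable, with the discrete sigma-algebra. *)
Definition discrete_rv {disp : measure_display} {Omega : measurableType disp}
    {T : Type} (X : Omega -> T) : Prop :=
  forall x, measurable (X @^-1` [set x]).

Definition sigma_param {Omega : Type} {R : realType} {d : nat}
    (X : Omega -> 'rV[R]_d) : set_system Omega :=
  preimage_set_system setT X <<s @open 'rV[R]_d >>.

Definition sigma_discrete {Omega T : Type} (X : Omega -> T) :
    set_system Omega :=
  preimage_set_system setT X setT.

(* The sigma-algebra generated by the parameters w 0, ..., w j and by the
   delays tau l k with k < i. *)
Definition history {Omega : Type} {R : realType} {d K : nat}
    (w : nat -> Omega -> 'rV[R]_d) (tau : 'I_K -> nat -> Omega -> nat)
    (j i : nat) : set_system Omega :=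
  <<s [set A | (exists k, (k <= j)%N /\ sigma_param (w k) A) \/
               (exists l k, (k < i)%N /\ sigma_discrete (tau l k) A)] >>.

(* Y is a version of the conditional expectation of X given the
   sigma-algebra G. *)
Definition cond_exp {disp : measure_display} {Omega : measurableType disp}
    {R : realType} (mu : probability Omega R) (G : set_system Omega)
    (X Y : Omega -> R) : Prop :=
  [/\ mu.-integrable setT (EFin \o X),
      mu.-integrable setT (EFin \o Y),
      forall B, measurable B -> G (Y @^-1` B)
    & forall A, G A ->
        (\int[mu]_(o in A) (X o)%:E = \int[mu]_(o in A) (Y o)%:E)%E].

Definition cond_exp_le {disp : measure_display} {Omega : measurableType disp}
    {R : realType} (mu : probability Omega R) (G : set_system Omega)
    (X Z : Omega -> R) : Prop :=
  exists2 Y, cond_exp mu G X Y & {ae mu, forall o, Y o <= Z o}.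

Definition cond_prob_ge {disp : measure_display} {Omega : measurableType disp}
    {R : realType} (mu : probability Omega R) (G : set_system Omega)
    (A : set Omega) (p : R) : Prop :=
  exists2 Y, cond_exp mu G (\1_A) Y & {ae mu, forall o, p <= Y o}.

(* Vector-valued conditional expectation, coordinatewise. *)
Definition cond_exp_vec {disp : measure_display} {Omega : measurableType disp}
    {R : realType} {d : nat} (mu : probability Omega R) (G : set_system Omega)
    (X Y : Omega -> 'rV[R]_d) : Prop :=
  forall i, cond_exp mu G (fun o => X o ord0 i) (fun o => Y o ord0 i).

(* G and the discrete random variables X l, l < K, are mutually independent;
   the product rule for subfamilies is the case where some C l are setT. *)
Definition mutually_independent {disp : measure_display}
    {Omega : measurableType disp} {R : realType} {T : Type} {K : nat}
    (mu : probability Omega R) (G : set_system Omega)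
    (X : 'I_K -> Omega -> T) : Prop :=
  forall A, G A -> forall C : 'I_K -> set T,
    (mu (A `&` \bigcap_l (X l @^-1` C l)) =
     mu A * \prod_(l < K) mu (X l @^-1` C l))%E.

(* Main.v *)
(* With finitely many workers and mini-batches, the J first iterations are
   functions of a random variable with values in a finite type, so that all
   expectations are finite sums.  Given the parameters and the delays, the K
   mini-batches have a fixed product law, and unbiasedness together with the
   variance bound holds for every value of w_k of positive probability.  The
   descent lemma, averaged over the mini-batches, gives
     E F(w_{j+1}) <= E F(w_j) - eta/K \sum_l E <G_j, G_l>
       + L eta^2 / 2 (sigma^2 / (K m)
                      + (M_G / (K m) + 1) / K \sum_l E |G_l|^2),
   where G_j and G_l are the gradients of F at w_j and w_tau(l,j).  By the
   polarization identity and the staleness bound,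
   2 E <G_j, G_l> >= (1 - gamma) E |G_j|^2 + E |G_l|^2; half of the last term
   absorbs the second-order term, and the other half is at least
   p0 / 2 E |G_j|^2 because tau(l,j) = j with conditional probability at least
   p0.  The resulting bounds are summed over j. *)
Require Import Defs.
From mathcomp Require Import all_boot all_order all_algebra.
From mathcomp Require Import all_classical all_reals all_analysis.
From mathcomp Require Import ring lra.
Import Order.TTheory GRing.Theory Num.Theory.
Import numFieldNormedType.Exports.
Local Open Scope classical_set_scope.
Local Open Scope ring_scope.

(** * Euclidean inner product and descent lemma *)

Definition dot {R : realType} {d : nat} (u v : 'rV[R]_d) : R :=
  \sum_(i < d) u ord0 i * v ord0 i.

Section dot_theory.
Context {R : realType} {d : nat}.
Implicit Types (u v w : 'rV[R]_d) (a : R).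

Lemma dotC u v : dot u v = dot v u.
Proof. by apply: eq_bigr => i _; rewrite mulrC. Qed.

Lemma dotDr u v w : dot u (v + w) = dot u v + dot u w.
Proof. by rewrite -big_split; apply: eq_bigr => i _; rewrite mxE mulrDr. Qed.

Lemma dotZr u a v : dot u (a *: v) = a * dot u v.
Proof. by rewrite mulr_sumr; apply: eq_bigr => i _; rewrite mxE mulrCA. Qed.

Lemma dotDl u v w : dot (u + v) w = dot u w + dot v w.
Proof. by rewrite dotC dotDr !(dotC w). Qed.

Lemma dotZl u a v : dot (a *: u) v = a * dot u v.
Proof. by rewrite dotC dotZr dotC. Qed.

Lemma dotNr u v : dot u (- v) = - dot u v.
Proof. by rewrite -scaleN1r dotZr mulN1r. Qed.

Lemma dotNl u v : dot (- u) v = - dot u v.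
Proof. by rewrite dotC dotNr dotC. Qed.

Lemma dot_sumr (I : finType) u (v : I -> 'rV[R]_d) :
  dot u (\sum_i v i) = \sum_i dot u (v i).
Proof.
rewrite exchange_big; apply: eq_bigr => k _.
by rewrite summxE mulr_sumr.
Qed.

Lemma dot_suml (I : finType) u (v : I -> 'rV[R]_d) :
  dot (\sum_i v i) u = \sum_i dot (v i) u.
Proof. by rewrite dotC dot_sumr; apply: eq_bigr => i _; rewrite dotC. Qed.

Lemma dot_ge0 u : 0 <= dot u u.
Proof. by apply: sumr_ge0 => i _; rewrite -expr2 sqr_ge0. Qed.

Lemma l2norm_sqr u : l2norm u ^+ 2 = dot u u.
Proof.
rewrite /l2norm (eq_bigr (fun i => u ord0 i * u ord0 i)); last first.
  by move=> i _; rewrite expr2.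
by rewrite sqr_sqrtr // dot_ge0.
Qed.

Lemma l2norm_ge0 u : 0 <= l2norm u. Proof. exact: sqrtr_ge0. Qed.

Lemma l2norm_eq0 u : l2norm u = 0 -> u = 0.
Proof.
move=> u0; have := l2norm_sqr u; rewrite u0 expr2 mul0r => /esym/eqP.
rewrite psumr_eq0 => [/allP uu|i _]; last by rewrite -expr2 sqr_ge0.
apply/rowP => i; rewrite mxE.
by have := uu i (mem_index_enum _); rewrite /= mulf_eq0 orbb => /eqP.
Qed.

Lemma l2normZ a u : 0 <= a -> l2norm (a *: u) = a * l2norm u.
Proof.
move=> a0; apply/eqP; rewrite -(@eqrXn2 _ 2)// ?mulr_ge0 ?l2norm_ge0//.
by rewrite exprMn !l2norm_sqr dotZl dotZr mulrA expr2.
Qed.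

(** Cauchy-Schwarz: the squared norm of [l2norm v *: u - l2norm u *: v] is nonnegative, and it
    equals twice the product of the norms times the difference of the two sides. *)
Lemma dot_le_l2norm u v : dot u v <= l2norm u * l2norm v.
Proof.
have [/l2norm_eq0 ->|u0] := eqVneq (l2norm u) 0.
  by rewrite -(scale0r (0 : 'rV[R]_d)) dotZl mul0r mulr_ge0 ?l2norm_ge0.
have [/l2norm_eq0 ->|v0] := eqVneq (l2norm v) 0.
  by rewrite -(scale0r (0 : 'rV[R]_d)) dotZr mul0r mulr_ge0 ?l2norm_ge0.
have uv0 : 0 < l2norm u * l2norm v.
  by rewrite mulr_gt0// lt_neqAle eq_sym ?u0 ?v0 l2norm_ge0.
have := dot_ge0 (l2norm v *: u - l2norm u *: v).
rewrite dotDl !dotDr !dotNl !dotNr !dotZl !dotZr (dotC v u) -!l2norm_sqr.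
rewrite -(ler_pM2l uv0 (dot u v)); lra.
Qed.

(** The difference of the two sides is half the sum of the squared distances over all pairs [v l],
    [v k]. *)
Lemma dot_sum_le (K : nat) (v : 'I_K -> 'rV[R]_d) :
  dot (\sum_l v l) (\sum_l v l) <= K%:R * \sum_l dot (v l) (v l).
Proof.
have : 0 <= \sum_l \sum_k dot (v l - v k) (v l - v k).
  by do 2!apply: sumr_ge0 => ? _; exact: dot_ge0.
have -> : \sum_l \sum_k dot (v l - v k) (v l - v k) =
   2 * (K%:R * \sum_l dot (v l) (v l) - dot (\sum_l v l) (\sum_l v l)).
  transitivity (\sum_(l < K) \sum_(k < K)
      (dot (v l) (v l) + dot (v k) (v k) - 2 * dot (v l) (v k))).
    apply: eq_bigr => l _; apply: eq_bigr => k _.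
    by rewrite dotDl !dotDr !dotNl !dotNr (dotC (v k) (v l)); ring.
  rewrite dot_suml mulr_sumr mulrBr !mulr_sumr -sumrB.
  have -> : \sum_(l < K) \sum_(k < K)
      (dot (v l) (v l) + dot (v k) (v k) - 2 * dot (v l) (v k)) =
    \sum_(l < K) (K%:R * dot (v l) (v l) - 2 * dot (v l) (\sum_k v k))
      + \sum_(l < K) \sum_(k < K) dot (v k) (v k).
    rewrite -big_split; apply: eq_bigr => l _.
    rewrite dot_sumr !big_split /= sumr_const card_ord -[dot _ _ *+ K]mulr_natl.
    by rewrite sumrN -[X in _ - X]mulr_sumr addrAC.
  rewrite [X in _ + X]sumr_const card_ord -[X in _ + X]mulr_natl.
  rewrite [X in _ + X]mulr_sumr -big_split.
  by apply: eq_bigr => l _ /=; ring.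
by lra.
Qed.

End dot_theory.

Section descent.
Context {R : realType} {d : nat}.
Implicit Types (F : 'rV[R]_d -> R) (u w : 'rV[R]_d).

Lemma derive_grad F u w : differentiable (F : _ -> R^o) w ->
  'D_u (F : _ -> R^o) w = dot (grad F w) u.
Proof.
move=> dF; rewrite deriveE// {1}(row_sum_delta u) linear_sum.
apply: eq_bigr => i _ /=; rewrite linearZ /= !mxE deriveE// mulrC.
by [].
Qed.

Lemma is_derive_line F w u (t : R) : (forall v, differentiable (F : _ -> R^o) v) ->
  is_derive t 1 (fun t : R => F (w + t *: u) : R^o)
    (dot (grad F (w + t *: u)) u).
Proof.
move=> dF; have /diff_derivable dv := dF (w + t *: u).
(* The difference quotient at [t] in direction 1 is that of [F] at [w + t *: u] in direction [u]. *)
have E : (fun h : R => h^-1 *: ((F (w + (h *: 1 + t) *: u) : R^o) - F (w + t *: u)))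
    = (fun h => h^-1 *: ((F (h *: u + (w + t *: u)) : R^o) - F (w + t *: u))).
  apply/funext => h; congr (_ *: (F _ - _)).
  by rewrite [h *: 1]mulr1 scalerDl addrCA.
split; first by have := dv u; rewrite /derivable /= E.
rewrite -derive_grad//.
by rewrite /derive /= E.
Qed.

Lemma descent_lemma F (L : R) w u : 0 <= L -> smooth L F ->
  F (w + u) <= F w + dot (grad F w) u + L / 2 * dot u u.
Proof.
move=> L0 [dF smF].
(* [h] is [F] along the segment minus the non-constant terms of the quadratic bound. The claim is
   [h 1 <= h 0], which the mean value theorem reduces to [dh c <= 0] for some [c] between 0 and
   1. *)
pose h (t : R) := F (w + t *: u) - t * dot (grad F w) u - L / 2 * dot u u * t ^+ 2 : R^o.
pose dh (t : R) := dot (grad F (w + t *: u)) u - dot (grad F w) u - L * dot u u * t.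
have dhE t : is_derive (t : R^o) (1 : R^o) h (dh t).
  have dF' := is_derive_line F w u t dF.
  rewrite /h /dh; apply: is_derive_eq.
  rewrite /GRing.scale /=. 
  by field.
have hcont : {within `[(0:R), 1], continuous h}.
  apply: continuous_subspaceT => t.
  by apply: differentiable_continuous; apply/derivable1_diffP.
have [c /andP[c0 c1]] := MVT_segment ler01 (fun t _ => dhE t) hcont.
rewrite subr0 mulr1 /h scale1r scale0r addr0 mul0r mul1r expr0n expr1n mulr0 !subr0 mulr1.
move=> e; suff : dh c <= 0 by rewrite -e; lra.
rewrite /dh -dotNl -dotDl.
move: c0; rewrite bnd_simp => c0.
(* Cauchy-Schwarz and the Lipschitz bound at distance [c * l2norm u] give exactly the term
   subtracted in [dh c]. *)
have := dot_le_l2norm (grad F (w + c *: u) - grad F w) u.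
have := smF (w + c *: u) w.
rewrite addrAC subrr add0r l2normZ// -l2norm_sqr.
have := l2norm_ge0 u; nra.
Qed.
End descent.

(** * Product laws and conditioning on finite types *)

Section product_weights.
Context {R : realType} {d K : nat} {B : finType}.
Variable q : 'I_K -> B -> R.
Hypothesis q_sum1 : forall l, \sum_b q l b = 1.

Let Q (c : {ffun 'I_K -> B}) : R := \prod_l q l (c l).

(** Distributivity of the product over the sum: under the weights [Q], the coordinates are
    independent. *)
Lemma product_weights_prod (phi : 'I_K -> B -> R) :
  \sum_c Q c * \prod_l phi l (c l) = \prod_l \sum_b q l b * phi l b.
Proof.
rewrite (bigA_distr_bigA (fun l b => q l b * phi l b)).
by apply: eq_bigr => c _; rewrite big_split.
Qed.

Lemma product_weights_marginal l (phi : B -> R) :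
  \sum_c Q c * phi (c l) = \sum_b q l b * phi b.
Proof.
(* The factors at the other coordinates are 1 and average to 1 because [q k] has total weight 1. *)
have := product_weights_prod (fun k b => if k == l then phi b else 1).
rewrite [RHS](bigD1 l)//= eqxx [X in _ = _ * X]big1 ?mulr1 => [<-|k /negPf ->].
  apply: eq_bigr => c _; rewrite (bigD1 l)//= eqxx big1 ?mulr1// => k.
  by move=> /negPf ->.
by under eq_bigr do rewrite mulr1.
Qed.

Lemma product_weights_marginal2 l k (phi psi : B -> R) : l != k ->
  \sum_c Q c * (phi (c l) * psi (c k)) =
  (\sum_b q l b * phi b) * (\sum_b q k b * psi b).
Proof.
move=> lk; have kl : k != l by rewrite eq_sym.
have := product_weights_prod
  (fun i b => if i == l then phi b else if i == k then psi b else 1).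
rewrite [RHS](bigD1 l)//= eqxx (bigD1 k)//= (negPf kl) eqxx.
rewrite [X in _ = _ * (_ * X)]big1 ?mulr1 => [<-|i /andP[/negPf-> /negPf->]].
  apply: eq_bigr => c _; rewrite (bigD1 l)//= eqxx (bigD1 k)//= (negPf kl) eqxx.
  by rewrite big1 ?mulr1// => i /andP[/negPf-> /negPf->].
by under eq_bigr do rewrite mulr1.
Qed.

Lemma product_weights_sum1 : \sum_c Q c = 1.
Proof.
transitivity (\sum_c Q c * \prod_(l < K) 1).
  by apply: eq_bigr => c _; rewrite big1_eq mulr1.
rewrite (product_weights_prod (fun _ _ => 1)) big1// => l _.
by under eq_bigr do rewrite mulr1.
Qed.

Variables (g : 'I_K -> B -> 'rV[R]_d) (mean : 'I_K -> 'rV[R]_d).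
Hypothesis gE : forall l, \sum_b q l b *: g l b = mean l.

Lemma mean_dot l u : \sum_b q l b * dot u (g l b) = dot u (mean l).
Proof. by rewrite -gE dot_sumr; apply: eq_bigr => b _; rewrite dotZr. Qed.

Lemma product_weights_dot l k : l != k ->
  \sum_c Q c * dot (g l (c l)) (g k (c k)) = dot (mean l) (mean k).
Proof.
move=> lk; under eq_bigr do rewrite mulr_sumr.
rewrite exchange_big; apply: eq_bigr => i _ /=.
rewrite (product_weights_marginal2 l k (fun b => g l b ord0 i)
  (fun b => g k b ord0 i) lk) -!gE !summxE.
by congr (_ * _); apply: eq_bigr => b _; rewrite mxE.
Qed.

(* Distinct workers are uncorrelated, so only the diagonal variances remain. *)
Lemma product_weights_second_moment :
  \sum_c Q c * dot (\sum_l g l (c l)) (\sum_l g l (c l)) =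
  \sum_l \sum_b q l b * dot (g l b - mean l) (g l b - mean l)
  + dot (\sum_l mean l) (\sum_l mean l).
Proof.
(* For [k = l] the second moment is the variance plus the squared mean; for [k != l] the expectation
   factors. *)
have E l k : \sum_c Q c * dot (g l (c l)) (g k (c k)) =
   (if k == l then \sum_b q l b * dot (g l b - mean l) (g l b - mean l) else 0)
   + dot (mean l) (mean k).
  have [->|kl] := eqVneq k l; last first.
    by rewrite add0r product_weights_dot// eq_sym.
  rewrite (product_weights_marginal l (fun b => dot (g l b) (g l b))).
  have -> : \sum_b q l b * dot (g l b - mean l) (g l b - mean l) =
      \sum_b (q l b * dot (g l b) (g l b) - 2 * (q l b * dot (mean l) (g l b))
        + q l b * dot (mean l) (mean l)).
    apply: eq_bigr => b _.
    by rewrite dotDl !dotDr !dotNl !dotNr (dotC (g l b) (mean l)); ring.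
  rewrite big_split /= sumrB -[X in _ - X]mulr_sumr mean_dot.
  rewrite -[X in _ - _ + X]mulr_suml q_sum1; ring.
transitivity (\sum_l \sum_k \sum_c Q c * dot (g l (c l)) (g k (c k))).
  under eq_bigr do rewrite dot_suml mulr_sumr.
  rewrite exchange_big; apply: eq_bigr => l _ /=.
  under eq_bigr do rewrite dot_sumr mulr_sumr.
  by rewrite exchange_big.
under eq_bigr => l _ do under eq_bigr do rewrite E.
rewrite dot_suml -big_split; apply: eq_bigr => l _ /=.
by rewrite dot_sumr big_split /= -big_mkcond big_pred1_eq.
Qed.

Variables (F : 'rV[R]_d -> R) (L s c : R) (w : 'rV[R]_d).
Hypotheses (q_ge0 : forall l b, 0 <= q l b) (L_ge0 : 0 <= L) (smF : smooth L F).
Hypothesis var_le : forall l,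
  \sum_b q l b * dot (g l b - mean l) (g l b - mean l)
  <= s + c * dot (mean l) (mean l).

(** The descent lemma is averaged over the product weights; the term [K%:R] comes from bounding the
    squared norm of the sum of the means. Here [eta] is the step per worker, to be instantiated with
    the learning rate divided by [K]. *)
Lemma expected_descent (eta : R) :
  \sum_e Q e * F (w - eta *: \sum_l g l (e l))
  <= F w - eta * \sum_l dot (grad F w) (mean l)
     + L / 2 * eta ^+ 2 * \sum_l (s + (c + K%:R) * dot (mean l) (mean l)).
Proof.
have Q_ge0 e : 0 <= Q e by apply: prodr_ge0.
apply: (@le_trans _ _ (\sum_e (Q e * F w
    - eta * \sum_l Q e * dot (grad F w) (g l (e l))
    + L / 2 * eta ^+ 2 * (Q e * dot (\sum_l g l (e l)) (\sum_l g l (e l)))))).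
  apply: ler_sum => e _.
  have := descent_lemma F L w (- (eta *: \sum_l g l (e l))) L_ge0 smF.
  move=> /(ler_wpM2l (Q_ge0 e)) /le_trans; apply; rewrite le_eqVlt.
  apply/orP; left; apply/eqP.
  rewrite -[X in _ = _ - eta * X + _]mulr_sumr dotNl !dotNr !dotZr !dotZl dot_sumr.
  by ring.
rewrite big_split sumrB /= -mulr_suml product_weights_sum1 mul1r.
rewrite -!mulr_sumr product_weights_second_moment exchange_big /=.
rewrite (eq_bigr (fun l => dot (grad F w) (mean l))); last first.
  by move=> l _; rewrite -mean_dot
    (product_weights_marginal l (fun b => dot (grad F w) (g l b))).
rewrite lerD2l; apply: ler_wpM2l.
  by apply: mulr_ge0; [exact: divr_ge0|exact: sqr_ge0].
apply: (@le_trans _ _ (\sum_(l < K) (s + c * dot (mean l) (mean l))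
    + K%:R * \sum_(l < K) dot (mean l) (mean l))).
  by apply: lerD; [apply: ler_sum|exact: dot_sum_le].
rewrite mulr_sumr -big_split /=; apply: ler_sum => l _.
by rewrite mulrDl addrA.
Qed.
End product_weights.

Section finite_conditioning.
Context {R : realType} {T : finType}.
Variable p : T -> R.
Hypothesis p_ge0 : forall t, 0 <= p t.

(** The sums are split along the image of [key], which is finite even when [C] is not. *)
Lemma ler_sum_classes {C : choiceType} (key : T -> C) (phi psi : T -> R) :
  (forall s, \sum_(t | key t == key s) phi t
             <= \sum_(t | key t == key s) psi t) ->
  \sum_t phi t <= \sum_t psi t.
Proof.
move=> le_class; pose k t := SeqSub (codom_f key t).
rewrite (partition_big k xpredT)//= [leRHS](partition_big k xpredT)//=.
apply: ler_sum => -[e ke] _; have [s es] := codomP ke.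
have kE t : (k t == SeqSub ke) = (key t == key s) by rewrite -val_eqE /= es.
by rewrite !(eq_bigl _ _ kE).
Qed.

Lemma sum_independent {Y : finType} (a : pred T) (y : T -> Y) (Q phi : Y -> R) :
  (forall b, \sum_(t | a t && (y t == b)) p t = (\sum_(t | a t) p t) * Q b) ->
  \sum_(t | a t) p t * phi (y t) = (\sum_(t | a t) p t) * \sum_b Q b * phi b.
Proof.
move=> ind; rewrite (partition_big y xpredT)//= mulr_sumr.
apply: eq_bigr => b _; rewrite mulrA -ind mulr_suml.
by apply: eq_bigr => t /andP[_ /eqP ->].
Qed.

(* Given the class of [key], [y] has law [Q], so that a conditional mean is
   computed by freezing what depends on the class only. *)
Lemma ler_sum_freezing {C : choiceType} {Y : finType} (key : T -> C) (y : T -> Y)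
    (Q : Y -> R) (G : T -> Y -> R) (H : T -> R) :
  (forall s b, \sum_(t | (key t == key s) && (y t == b)) p t =
               (\sum_(t | key t == key s) p t) * Q b) ->
  (forall s t, key s = key t -> G s = G t) ->
  (forall s t, key s = key t -> H s = H t) ->
  (forall s, 0 < \sum_(t | key t == key s) p t -> \sum_b Q b * G s b <= H s) ->
  \sum_t p t * G t (y t) <= \sum_t p t * H t.
Proof.
move=> ind GE HE GH; apply: (ler_sum_classes key) => s.
rewrite (eq_bigr (fun t => p t * G s (y t))); last by move=> t /eqP/GE ->.
rewrite [leRHS](eq_bigr (fun t => p t * H s)); last by move=> t /eqP/HE ->.
rewrite (sum_independent _ _ _ _ (ind s)) -mulr_suml.
have : 0 <= \sum_(t | key t == key s) p t by exact: sumr_ge0.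
(* A class of weight zero contributes zero to both sides, so [GH] is called only on classes of
   positive weight. *)
rewrite le_eqVlt => /predU1P[<-|/[dup] /GH GHs pos]; first by rewrite !mul0r.
by rewrite ler_pM2l.
Qed.

(** As [phi] is constant on each class, the lower bound on the share of [b] in the class can be
    multiplied by that value and summed. *)
Lemma ler_sum_event {C : choiceType} (key : T -> C) (b : pred T) (r : R)
    (phi : T -> R) :
  (forall s, r * \sum_(t | key t == key s) p t
             <= \sum_(t | (key t == key s) && b t) p t) ->
  (forall s t, key s = key t -> phi s = phi t) -> (forall t, 0 <= phi t) ->
  r * \sum_t p t * phi t <= \sum_(t | b t) p t * phi t.
Proof.
move=> rb phiE phi_ge0; rewrite mulr_sumr [leRHS]big_mkcond.
apply: (ler_sum_classes key) => s; rewrite -big_mkcondr.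
rewrite (eq_bigr (fun t => r * p t * phi s)); last first.
  by move=> t /eqP/phiE ->; rewrite mulrA.
rewrite [leRHS](eq_bigr (fun t => p t * phi s)); last first.
  by move=> t /andP[/eqP/phiE ->].
by rewrite -!mulr_suml -mulr_sumr ler_wpM2r.
Qed.

End finite_conditioning.

(** * Finite-valued random variables *)

Lemma sigma_algebra_fin_bigcap {disp : measure_display}
    {Omega : measurableType disp} {I : finType} (G : set_system Omega)
    (A : I -> set Omega) :
  (forall i, <<s G >> (A i)) -> <<s G >> (\bigcap_i A i).
Proof.
move=> GA.
apply: (@fin_bigcap_measurable _ (g_sigma_algebraType G) I setT A) => [|i _].
  exact: finite_finset.
exact: GA.
Qed.

(** The difference [g \- f] agrees almost everywhere with its absolute value, whose integral is
    nonnegative. *)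
Lemma ae_le_integral {disp : measure_display} {Omega : measurableType disp}
    {R : realType} (mu : {measure set Omega -> \bar R}) (D : set Omega)
    (f g : Omega -> R) :
  measurable D -> mu.-integrable setT (EFin \o f) ->
  mu.-integrable setT (EFin \o g) -> {ae mu, forall o, f o <= g o} ->
  (\int[mu]_(o in D) (f o)%:E <= \int[mu]_(o in D) (g o)%:E)%E.
Proof.
move=> mD intf intg fg.
have {}intf : mu.-integrable D (EFin \o f) by exact: integrableS intf.
have {}intg : mu.-integrable D (EFin \o g) by exact: integrableS intg.
rewrite -sube_ge0; last by apply/orP; left; exact: (integrable_fin_num mD intf).
rewrite -(integralB_EFin mD intg intf).
have intB : mu.-integrable D (EFin \o (g \- f)).
  exact: (integrableB mD intg intf).
rewrite (ae_eq_integral (abse \o (EFin \o (g \- f))))//.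
- by apply: integral_ge0 => o _; exact: abse_ge0.
- exact: (measurable_int _ intB).
- exact: (measurable_int _ (integrable_abse intB)).
- apply: filterS fg => o fgo _ /=.
  by rewrite ger0_norm// subr_ge0.
Qed.

Section finite_law.
Context {disp : measure_display} {Omega : measurableType disp} {R : realType}.
Variable mu : probability Omega R.
Context {T : finType}.
Variable h : Omega -> T.
Hypothesis h_rv : discrete_rv h.

Definition law (t : T) : R := fine (mu (h @^-1` [set t])).

Lemma law_ge0 t : 0 <= law t.
Proof. by rewrite /law fine_ge0. Qed.

Lemma measurable_law (a : pred T) : measurable [set o | a (h o)].
Proof.
have -> : [set o | a (h o)] = \bigcup_(t in [set` a]) h @^-1` [set t].
  by apply/seteqP; split => [x ax|x [t ta /= ->]]; [exists (h x)|].
by apply: fin_bigcup_measurable => //; exact: finite_finset.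
Qed.

Lemma integrable_law (x : T -> R) :
  mu.-integrable setT (fun o => (x (h o))%:E).
Proof.
have -> : (fun o => (x (h o))%:E) =
    (fun o => \sum_t ((x t)%:E * (\1_(h @^-1` [set t]) o)%:E)%E).
  apply/funext => o; rewrite (bigD1 (h o))//= indicE mem_set// mule1.
  rewrite big1 ?adde0// => t th; rewrite indicE memNset ?mule0//= => ht.
  by rewrite ht eqxx in th.
apply: integrable_sum => // t _; apply: integrableZl => //.
exact: integrable_indic.
Qed.

(** [x (h o)] is a finite combination of indicators of the fibres of [h], and each fibre is either
    contained in the event or disjoint from it. *)
Lemma integral_law (a : pred T) (x : T -> R) :
  (\int[mu]_(o in [set o | a (h o)]) (x (h o))%:E =
   (\sum_(t | a t) law t * x t)%:E)%E.
Proof.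
have mA := measurable_law a.
transitivity (\int[mu]_(o in [set o | a (h o)])
    (\sum_t ((x t)%:E * (\1_(h @^-1` [set t]) o)%:E)))%E.
  apply: eq_integral => o _; rewrite (bigD1 (h o))//= indicE mem_set// mule1.
  rewrite big1 ?adde0// => t th; rewrite indicE memNset ?mule0//= => ht.
  by rewrite ht eqxx in th.
have int1 t : mu.-integrable [set o | a (h o)]
    (fun o => (\1_(h @^-1` [set t]) o)%:E).
  by apply: (@integrableS _ _ _ _ setT) => //; exact: integrable_indic.
rewrite integral_sum//; last by move=> t; exact: integrableZl.
rewrite [in RHS]big_mkcond /= -sumEFin; apply: eq_bigr => t _.
rewrite integralZl// integral_indic//.
case: ifPn => ta; last first.
  have -> : h @^-1` [set t] `&` [set o | a (h o)] = set0.
    by apply/seteqP; split => // o /= [->]; rewrite (negPf ta).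
  by rewrite measure0 mule0.
rewrite setIidl; last by move=> o /= ->.
by rewrite /law EFinM muleC fineK// fin_num_measure.
Qed.

Lemma mu_law (a : pred T) :
  mu [set o | a (h o)] = (\sum_(t | a t) law t)%:E.
Proof.
have mA := measurable_law a.
have := integral_law a (fun _ => 1); rewrite integral_cst// mul1e => ->.
by under eq_bigr do rewrite mulr1.
Qed.

Lemma law_sum1 : \sum_t law t = 1.
Proof.
apply: EFin_inj; rewrite -mu_law -[RHS](probability_setT mu).
by congr (mu _); apply/seteqP; split.
Qed.

Lemma expectation_law (x : T -> R) :
  ('E_mu[fun o => x (h o)] = (\sum_t law t * x t)%:E)%E.
Proof.
rewrite unlock -integral_law.
by congr (integral _ _ _); apply/seteqP; split.
Qed.

Variable G : set_system Omega.

(** The defining identity of a conditional expectation, tested on an event of [G] that is expressed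
    through [h], becomes an identity between finite sums. *)
Lemma cond_exp_law (x y : T -> R) (a : pred T) :
  cond_exp mu G (fun o => x (h o)) (fun o => y (h o)) -> G [set o | a (h o)] ->
  \sum_(t | a t) law t * x t = \sum_(t | a t) law t * y t.
Proof. by move=> [_ _ _ /[apply]]; rewrite !integral_law => -[]. Qed.

Lemma cond_exp_le_law (x y : T -> R) (a : pred T) :
  cond_exp_le mu G (fun o => x (h o)) (fun o => y (h o)) ->
  G [set o | a (h o)] ->
  \sum_(t | a t) law t * x t <= \sum_(t | a t) law t * y t.
Proof.
move=> [Y [_ intY _ GY] Yy] Ga; rewrite -lee_fin -!integral_law GY//.
by apply: ae_le_integral => //; [exact: measurable_law|exact: integrable_law].
Qed.

Lemma cond_prob_ge_law (b a : pred T) (q : R) :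
  cond_prob_ge mu G [set o | b (h o)] q -> G [set o | a (h o)] ->
  q * \sum_(t | a t) law t <= \sum_(t | a t && b t) law t.
Proof.
move=> [Y [_ intY _ GY] Yq] Ga; rewrite mulr_sumr.
have -> : \sum_(t | a t) q * law t = \sum_(t | a t) law t * q.
  by apply: eq_bigr => t _; rewrite mulrC.
have -> : \sum_(t | a t && b t) law t = \sum_(t | a t) law t * (b t)%:R.
  rewrite big_mkcondr; apply: eq_bigr => t _.
  by case: (b t); rewrite ?mulr1 ?mulr0.
rewrite -lee_fin -(integral_law a (fun=> q)) -integral_law.
rewrite [leRHS](_ : _ = \int[mu]_(o in [set o | a (h o)])
    (\1_[set o | b (h o)] o)%:E)%E.
  rewrite GY//; apply: ae_le_integral => //; first exact: measurable_law.
  exact: (integrable_law (fun=> q)).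
apply: eq_integral => o _; rewrite indicE; congr ((nat_of_bool _)%:R%:E).
by apply/idP/idP => [?|/set_mem//]; exact/mem_set.
Qed.

End finite_law.

(** * One step of K-async SGD *)

Section one_step.
Context {R : realType} {d K : nat} {T B : finType} {C : choiceType}.
(** For an outcome of weight [p], [v] is the current parameter, [r l] the possibly stale one read by
    the l-th worker and [y] the family of mini-batches. [key] stands for the past on which [v] and
    [r] depend; [s] and [c] stand for the two constants of the variance bound. *)
Variables (p : T -> R) (F : 'rV[R]_d -> R) (L s c eta gamma p0 : R).
Variables (g : 'rV[R]_d -> B -> 'rV[R]_d) (v : T -> 'rV[R]_d).
Variables (r : 'I_K -> T -> 'rV[R]_d) (y : T -> {ffun 'I_K -> B}).
Variables (q : 'I_K -> B -> R) (key : T -> C).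
Hypotheses (K_gt0 : (0 < K)%N) (p_ge0 : forall t, 0 <= p t).
Hypothesis q_ge0 : forall l b, 0 <= q l b.
Hypothesis q_sum1 : forall l, \sum_b q l b = 1.
Hypothesis ind : forall s b, \sum_(t | (key t == key s) && (y t == b)) p t =
  (\sum_(t | key t == key s) p t) * \prod_l q l (b l).
Hypothesis key_v : forall s t, key s = key t -> v s = v t.
Hypothesis key_r : forall l s t, key s = key t -> r l s = r l t.
Hypotheses (L_ge0 : 0 <= L) (smF : smooth L F) (eta_gt0 : 0 < eta).
Hypothesis mean_eq : forall t l, 0 < \sum_(u | key u == key t) p u ->
  \sum_b q l b *: g (r l t) b = grad F (r l t).
Hypothesis var_le : forall t l, 0 < \sum_(u | key u == key t) p u ->
  \sum_b q l b * dot (g (r l t) b - grad F (r l t)) (g (r l t) b - grad F (r l t))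
  <= s + c * dot (grad F (r l t)) (grad F (r l t)).
Hypothesis stale_le : forall l,
  \sum_t p t * dot (grad F (v t) - grad F (r l t)) (grad F (v t) - grad F (r l t))
  <= gamma * \sum_t p t * dot (grad F (v t)) (grad F (v t)).
Hypothesis fresh_ge : forall l,
  p0 * \sum_t p t * dot (grad F (v t)) (grad F (v t))
  <= \sum_t p t * dot (grad F (r l t)) (grad F (r l t)).
Hypothesis eta_le : 2 * L * eta * (c / K%:R + 1) <= 1.
Hypothesis p_sum1 : \sum_t p t = 1.

Lemma async_one_step :
  \sum_t p t * F (v t - (eta / K%:R) *: \sum_l g (r l t) (y t l))
  <= \sum_t p t * F (v t)
     - eta / 2 * (1 - gamma + p0 / 2)
       * \sum_t p t * dot (grad F (v t)) (grad F (v t))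
     + L * eta ^+ 2 * s / (2 * K%:R).
Proof.
have KR : 0 < K%:R :> R by rewrite ltr0n.
pose e := eta / K%:R.
have eK : eta = e * K%:R by rewrite /e divfK// gt_eqF.
have e_gt0 : 0 < e by rewrite divr_gt0.
pose H t := F (v t) - e * \sum_l dot (grad F (v t)) (grad F (r l t))
  + L / 2 * e ^+ 2 * \sum_l (s + (c + K%:R) *
      dot (grad F (r l t)) (grad F (r l t))).
(* [H t] bounds the mean over the mini-batches given the class of [t], in which [v] and [r] are
   frozen. *)
apply: (@le_trans _ _ (\sum_t p t * H t)).
  apply: (ler_sum_freezing p p_ge0 key y (fun b => \prod_l q l (b l))
    (fun t b => F (v t - (eta / K%:R) *: \sum_l g (r l t) (b l))) H ind).
  - move=> t u tu; apply/funext => b; rewrite (key_v _ _ tu).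
    by under eq_bigr do rewrite (key_r _ _ _ tu).
  - move=> t u tu; rewrite /H (key_v _ _ tu).
    by congr (_ - _ * _ + _ * _); apply: eq_bigr => l _; rewrite (key_r _ _ _ tu).
  move=> t t_pos.
  by apply: (expected_descent q q_sum1 (fun l => g (r l t))) => // l;
    [exact: mean_eq|exact: var_le].
pose n := \sum_t p t * dot (grad F (v t)) (grad F (v t)).
pose a l := \sum_t p t * dot (grad F (r l t)) (grad F (r l t)).
pose D l := \sum_t p t * dot (grad F (v t)) (grad F (r l t)).
have -> : \sum_t p t * H t = \sum_t p t * F (v t)
    + \sum_l (- e * D l + L / 2 * e ^+ 2 * (s + (c + K%:R) * a l)).
  transitivity (\sum_t (p t * F (v t) + \sum_l (- e * (p t * dot (grad F (v t))
     (grad F (r l t))) + L / 2 * e ^+ 2 * (s * p t + (c + K%:R) *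
      (p t * dot (grad F (r l t)) (grad F (r l t))))))).
    apply: eq_bigr => t _; rewrite /H -addrA mulrDr; congr (_ + _).
    rewrite -mulNr !mulr_sumr -big_split mulr_sumr.
    by apply: eq_bigr => l _ /=; ring.
  rewrite big_split exchange_big /=; congr (_ + _); apply: eq_bigr => l _.
  by rewrite big_split -!mulr_sumr big_split -!mulr_sumr p_sum1 mulr1.
(* Polarization: the left side of [stale_le] expands to [n - 2 * D l + a l]. *)
have D_ge l : (1 - gamma) * n / 2 + a l / 2 <= D l.
  have := stale_le l.
  have -> : \sum_t p t * dot (grad F (v t) - grad F (r l t))
      (grad F (v t) - grad F (r l t)) = n - 2 * D l + a l.
    rewrite /n /D /a mulr_sumr -sumrB -big_split; apply: eq_bigr => t _ /=.
    by rewrite dotDl !dotDr !dotNl !dotNr (dotC (grad F (r l t))); ring.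
  by rewrite -/n; lra.
have a_ge0 l : 0 <= a l.
  by apply: sumr_ge0 => t _; rewrite mulr_ge0// dot_ge0.
(* By this bound the second-order term is at most [a l / 4]. Of the [a l / 2] in [D_ge] there
   remains [a l / 4], at least [p0 * n / 4] by [fresh_ge], whence the [p0 / 2] in the final
   factor. *)
have Le : L * e * (c + K%:R) <= 2^-1.
  have <- : L * eta * (c / K%:R + 1) = L * e * (c + K%:R).
    by rewrite /e; field; rewrite gt_eqF.
  by move: eta_le; lra.
rewrite -addrA lerD2l.
(* The target is cut into [K] equal shares, so that the inequality can be proved for each worker
   separately. *)
apply: (@le_trans _ _ (\sum_(l < K) (e * (L / 2 * e * s
    - (1 - gamma + p0 / 2) * n / 2)))); last first.
  rewrite sumr_const card_ord -mulr_natl le_eqVlt; apply/orP; left; apply/eqP.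
  by rewrite -/n eK; field; rewrite gt_eqF.
apply: ler_sum => l _.
have -> : - e * D l + L / 2 * e ^+ 2 * (s + (c + K%:R) * a l) =
   e * (- D l + L / 2 * e * s + 2^-1 * (L * e * (c + K%:R) * a l)) by field.
rewrite ler_pM2l//.
have := ler_wpM2r (a_ge0 l) Le.
have := D_ge l; have := fresh_ge l; rewrite -/n -/(a l).
by move: (L * e * (c + K%:R) * a l) => z; lra.
Qed.

End one_step.

(** * Delays and events of the history *)

Lemma last_read_le {K P : nat} (S : nat -> 'I_K -> 'I_P) (p : 'I_P) (j : nat) :
  (last_read S p j <= j)%N.
Proof. by elim: j => //= j IH; case: ifP => // _; exact: leqW. Qed.

(** Used to see the delays as functions of the workers selected so far. *)
Lemma last_read_ext {K P : nat} (S S' : nat -> 'I_K -> 'I_P) (p : 'I_P) (j : nat) :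
  (forall i l, (i < j)%N -> S i l = S' i l) -> last_read S p j = last_read S' p j.
Proof.
elim: j => //= j IH SS'; rewrite IH; last by move=> i l /leqW; exact: SS'.
congr (if _ then _ else _); apply: eq_existsb => l.
by rewrite SS'.
Qed.


Section history_events.
Context {disp : measure_display} {Omega : measurableType disp}.
Context {R : realType} {d K : nat}.
Variables (w : nat -> Omega -> 'rV[R]_d) (tau : 'I_K -> nat -> Omega -> nat).

(** Points are closed in a Hausdorff space, so [[set v]] is the complement of an open set. *)
Lemma sigma_param_event (X : Omega -> 'rV[R]_d) (v : 'rV[R]_d) :
  sigma_param X [set o | X o == v].
Proof.
exists [set v]; last first.
  by rewrite setTI; apply/seteqP; split => o /= /eqP.
rewrite -[[set v]]setCK; apply: sigma_algebraC; apply: sub_sigma_algebra.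
apply: closed_openC; apply: accessible_closed_set1.
exact/hausdorff_accessible/norm_hausdorff.
Qed.

Lemma history_param (j i k : nat) (v : 'rV[R]_d) : (k <= j)%N ->
  history w tau j i [set o | w k o == v].
Proof.
move=> kj; apply: sub_sigma_algebra; left; exists k; split=> //.
exact: sigma_param_event.
Qed.

(** A finite intersection of elementary events. The bound [j.+1] on the delays is strict, so those
    of update [j] are included. *)
Lemma history_param_delay (j : nat) (v : {ffun 'I_j.+1 -> 'rV[R]_d})
    (n : {ffun 'I_K -> nat}) :
  history w tau j j.+1
    [set o | ([ffun k : 'I_j.+1 => w k o], [ffun l => tau l j o]) == (v, n)].
Proof.
have -> : [set o | ([ffun k : 'I_j.+1 => w k o], [ffun l => tau l j o]) == (v, n)]
    = \bigcap_(i : 'I_j.+1 + 'I_K) match i with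
        | inl k => [set o | w k o == v k]
        | inr l => [set o | tau l j o == n l] end.
  apply/seteqP; split => [x /eqP[<- <-] [k|l] _ /=|x oi /=].
  - by rewrite ffunE.
  - by rewrite ffunE.
  - apply/eqP; congr pair; apply/ffunP => k; rewrite ffunE; apply/eqP.
    + exact: (oi (inl k) I).
    + exact: (oi (inr k) I).
apply: sigma_algebra_fin_bigcap => -[k|l].
  exact: (history_param j j.+1 k (v k) (ltn_ord k)).
apply: sub_sigma_algebra; right; exists l, j; split=> //.
exists [set n l] => //.
by rewrite setTI; apply/seteqP; split => o /= /eqP.
Qed.

End history_events.

(** * Convergence of the averaged squared gradient norms *)

Theorem theorem4
  (R : realType) (d N m K P J : nat)
  (N_gt0 : (0 < N)%N) (m_gt0 : (0 < m)%N)
  (K_gt0 : (0 < K)%N) (K_le_P : (K <= P)%N) (J_gt0 : (0 < J)%N)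
  (disp : measure_display) (Omega : measurableType disp)
  (mu : probability Omega R)
  (f : 'I_N -> 'rV[R]_d -> R) (Fstar eta L sigma M_G gamma p0 : R)
  (w0 : 'rV[R]_d) (w : nat -> Omega -> 'rV[R]_d)
  (worker : nat -> 'I_K -> Omega -> 'I_P)
  (xi : 'I_K -> nat -> Omega -> m.-tuple 'I_N) :
  let F := empirical_risk f in
  let tau := read_index worker in
  let gamma' := 1 - gamma + p0 / 2 in
  (forall n v, differentiable (f n : _ -> R^o) v) ->
  is_minimum F Fstar ->
  (* K-async SGD *)
  (forall j l, (j < J)%N -> discrete_rv (worker j l)) ->
  (forall j o, (j < J)%N -> injective (fun l => worker j l o)) ->
  (forall j l, (j < J)%N -> discrete_rv (xi l j)) ->
  (forall o, w 0%N o = w0) ->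
  (forall j o, (j < J)%N ->
     w j.+1 o = w j o - (eta / K%:R) *:
       \sum_(l < K) batch_grad f (w (tau l j o) o) (xi l j o)) ->
  (* smoothness *)
  0 <= L -> smooth L F ->
  (* fresh mini-batches *)
  (forall j, (j < J)%N ->
     mutually_independent mu (history w tau j j.+1) (fun l => xi l j)) ->
  (* unbiasedness *)
  (forall j l k, (j < J)%N -> (k <= j)%N ->
     cond_exp_vec mu (sigma_param (w k))
       (fun o => batch_grad f (w k o) (xi l j o))
       (fun o => grad F (w k o))) ->
  (* bounded variance *)
  (forall j l k, (j < J)%N -> (k <= j)%N ->
     cond_exp_le mu (sigma_param (w k))
       (fun o => l2norm (batch_grad f (w k o) (xi l j o) - grad F (w k o)) ^+ 2)
       (fun o => sigma ^+ 2 / m%:R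
                 + M_G / m%:R * l2norm (grad F (w k o)) ^+ 2)) ->
  (* staleness bound *)
  gamma <= 1 ->
  (forall j l, (j < J)%N ->
     ('E_mu[(fun o => l2norm (grad F (w j o) - grad F (w (tau l j o) o)) ^+ 2)%R]
      <= gamma%:E * 'E_mu[(fun o => l2norm (grad F (w j o)) ^+ 2)%R])%E) ->
  (* lower bound on the probability of an up-to-date gradient *)
  (forall j l, (j < J)%N ->
     cond_prob_ge mu (history w tau j j) [set o | tau l j o = j] p0) ->
  0 < gamma' ->
  (* learning rate *)
  0 < eta ->
  2 * L * eta * (M_G / (K * m)%:R + 1) <= 1 ->
  ((J%:R^-1)%:E *
     \sum_(0 <= j < J) 'E_mu[(fun o => l2norm (grad F (w j o)) ^+ 2)%R]
   <= ((2 * (F w0 - Fstar)) / (J%:R * eta * gamma')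
       + (L * eta * sigma ^+ 2) / (K%:R * m%:R * gamma'))%:E)%E.

Proof.
move=> F tau gamma' f_diff Fmin worker_rv _ xi_rv w_0 w_S L_ge0 smF xi_ind.
move=> xi_mean xi_var _ stale fresh gamma'_gt0 eta_gt0 eta_le.
(* [T] records the workers and mini-batches of all [J] updates; parameters and delays will be shown
   to depend on this record only. *)
pose T : finType := {ffun 'I_J * 'I_K -> 'I_P * m.-tuple 'I_N}.
pose h (o : Omega) : T :=
  [ffun jl : 'I_J * 'I_K => (worker jl.1 jl.2 o, xi jl.2 jl.1 o)].
have h_rv : discrete_rv h.
  move=> t; have -> : h @^-1` [set t] = \bigcap_(jl : 'I_J * 'I_K)
      (worker jl.1 jl.2 @^-1` [set (t jl).1] `&`
       xi jl.2 jl.1 @^-1` [set (t jl).2]).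
    apply/seteqP; split => [x <- jl _|x tx]; first by rewrite /h ffunE.
    apply/ffunP => jl; have [/= e1 e2] := tx jl Logic.I.
    by rewrite ffunE e1 e2 -surjective_pairing.
  apply: fin_bigcap_measurable => [|jl _]; first exact: finite_finset.
  by apply: measurableI; [exact: worker_rv|exact: xi_rv].
have hE o o' j l : h o = h o' -> (j < J)%N ->
    worker j l o = worker j l o' /\ xi l j o = xi l j o'.
  move=> /ffunP hh jJ; have := hh (Ordinal jJ, l).
  by rewrite !ffunE => -[].
have tauE o o' j l : h o = h o' -> (j < J)%N -> tau l j o = tau l j o'.
  move=> hh jJ; rewrite /tau /read_index (hE _ _ _ l hh jJ).1.
  apply: last_read_ext => i k ij.
  by have [] := hE o o' i k hh (ltn_trans ij jJ).
have wE o o' j : h o = h o' -> (j <= J)%N -> w j o = w j o'.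
  (* Strong induction, since an update may use a parameter of any earlier index. *)
  move=> hh; elim/ltn_ind: j => -[|j] IH jJ; first by rewrite !w_0.
  rewrite (w_S j o jJ) (w_S j o' jJ) (IH j (ltnSn j) (ltnW jJ)).
  congr (_ - _ *: _); apply: eq_bigr => l _.
  rewrite (hE o o' j l hh jJ).2 (tauE o o' j l hh jJ).
  have tj : (tau l j o' <= j)%N by exact: last_read_le.
  by rewrite (IH _ _ (leq_trans tj (ltnW jJ))).
(* A representative outcome for each record. Records that never occur get the default [point], and
   have weight zero. *)
pose rep (t : T) := xget point (h @^-1` [set t]).
have repK o : h (rep (h o)) = h o.
  exact: (@xgetPex _ point (h @^-1` [set h o]) (ex_intro _ o erefl)).
pose p := law mu h.
have p_ge0 t : 0 <= p t by exact: law_ge0.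
have p_sum1 : \sum_t p t = 1 by exact: law_sum1.
pose W k t := w k (rep t).
pose n j := \sum_t p t * dot (grad F (W j t)) (grad F (W j t)).
have EE j : (j < J)%N ->
    ('E_mu[(fun o => l2norm (grad F (w j o)) ^+ 2)%R] = (n j)%:E)%E.
  move=> jJ; rewrite -expectation_law//; congr ('E_mu[_])%E.
  apply/funext => o.
  by rewrite l2norm_sqr /W (wE o (rep (h o)))// ltnW.
pose e j := \sum_t p t * F (W j t).
have step j : (j < J)%N -> e j.+1 <=
    e j - eta / 2 * gamma' * n j + L * eta ^+ 2 * (sigma ^+ 2 / m%:R) / (2 * K%:R).
  move=> jJ.
  have XE o l : xi l j (rep (h o)) = xi l j o.
    by have [] := hE _ _ j l (repK o) jJ.
  have tE o l : tau l j (rep (h o)) = tau l j o by exact: tauE (repK o) jJ.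
  have WE o k : (k <= j)%N -> W k (h o) = w k o.
    by move=> kj; apply: wE (repK o) (leq_trans kj (ltnW jJ)).
  have tau_le l o : (tau l j o <= j)%N by exact: last_read_le.
  have W_S t : W j.+1 t = W j t - (eta / K%:R) *:
      \sum_l batch_grad f (W (tau l j (rep t)) t) (xi l j (rep t)).
    exact: w_S.
  clearbody W rep h tau F.
  pose v t := W j t.
  pose r l t := W (tau l j (rep t)) t.
  pose y t : {ffun 'I_K -> m.-tuple 'I_N} := [ffun l => xi l j (rep t)].
  (* The unconditional law of the l-th mini-batch; by independence it is also its law given the
     history. *)
  pose q l b := \sum_(t | xi l j (rep t) == b) p t.
  have q_sum1 l : \sum_b q l b = 1.
    by rewrite -p_sum1 [RHS](partition_big (fun t => xi l j (rep t)) predT).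
  have q_mu l b : mu (xi l j @^-1` [set b]) = (q l b)%:E.
    rewrite -(mu_law mu h h_rv); congr (mu _).
    by apply/seteqP; split => x /=; rewrite XE => /eqP.
  have ind (a : pred T) : history w tau j j.+1 [set o | a (h o)] -> forall b,
      \sum_(t | a t && (y t == b)) p t = (\sum_(t | a t) p t) * \prod_l q l (b l).
    move=> Ha b; apply: EFin_inj; rewrite EFinM -prodEFin -!(mu_law mu h h_rv).
    under eq_bigr do rewrite -q_mu.
    rewrite -(xi_ind j jJ _ Ha (fun l => [set b l])); congr (mu _).
    apply/seteqP; split => x /=.
      by move=> /andP[ax /eqP <-]; split => // l _; rewrite /= ffunE XE.
    move=> [-> xb]; apply/eqP/ffunP => l; rewrite ffunE XE.
    exact: (xb l Logic.I).
  have ind1 (a : pred T) : history w tau j j.+1 [set o | a (h o)] ->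
      forall l (phi : m.-tuple 'I_N -> R),
      \sum_(t | a t) p t * phi (xi l j (rep t)) =
      (\sum_(t | a t) p t) * \sum_b q l b * phi b.
    move=> Ha l phi; rewrite -(product_weights_marginal q q_sum1).
    rewrite -(sum_independent p a y _ (fun b => phi (b l)) (ind a Ha)).
    by apply: eq_bigr => t _; rewrite ffunE.
  (* All parameters up to [j] together with the delays of update [j] determine every parameter that
     this update reads. *)
  pose key t : {ffun 'I_j.+1 -> 'rV[R]_d} * {ffun 'I_K -> nat} :=
    ([ffun k : 'I_j.+1 => W k t], [ffun l => tau l j (rep t)]).
  have key_hist s : history w tau j j.+1 [set o | key (h o) == key s].
    have -> : [set o | key (h o) == key s] = [set o |
        ([ffun k : 'I_j.+1 => w k o], [ffun l => tau l j o]) == key s].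
      apply/seteqP; split => x /=; rewrite /key;
        (suff -> : [ffun k : 'I_j.+1 => W k (h x)] = [ffun k : 'I_j.+1 => w k x];
        [suff -> : [ffun l => tau l j (rep (h x))] = [ffun l => tau l j x] by [];
         by apply/ffunP => l; rewrite !ffunE tE|
         by apply/ffunP => k; rewrite !ffunE WE// -ltnS]).
    exact: history_param_delay.
  have key_W s t k : key s = key t -> (k <= j)%N -> W k s = W k t.
    move=> [/ffunP kw _] kj; have := kw (Ordinal (kj : (k < j.+1)%N)).
    by rewrite !ffunE.
  have key_tau s t l : key s = key t -> tau l j (rep s) = tau l j (rep t).
    by move=> [_ /ffunP /(_ l)]; rewrite !ffunE.
  (* Unbiasedness and the variance bound are conditional on a single [w k]. A class of [key] lies in
     a class of [W k], which therefore inherits its positive weight. *)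
  have W_ge k s : (k <= j)%N ->
      \sum_(t | key t == key s) p t <= \sum_(t | W k t == W k s) p t.
    move=> kj; rewrite big_mkcond [leRHS]big_mkcond; apply: ler_sum => t _.
    case: ifPn => [/eqP kts|_]; last by case: ifP.
    by rewrite (key_W _ _ k kts kj) eqxx.
  have W_event k s : (k <= j)%N ->
      [set o | W k (h o) == W k s] = [set o | w k o == W k s].
    by move=> kj; apply/seteqP; split => x /=; rewrite WE.
  (* With the delay frozen to [k], the mini-batch is independent of the event that [W k] takes its
     value at [s]. Hence its mean under [q l] is the conditional mean on that event, obtained by
     cancelling the positive weight. *)
  have mean s l : 0 < \sum_(t | key t == key s) p t ->
      \sum_b q l b *: batch_grad f (r l s) b = grad F (r l s).
    move=> s_pos; have kj := tau_le l (rep s).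
    have := lt_le_trans s_pos (W_ge _ s kj).
    rewrite /r; set k := tau l j (rep s) in kj *; set a := fun t => W k t == W k s.
    move=> a_pos; apply/rowP => i; apply: (mulfI (lt0r_neq0 a_pos)).
    rewrite summxE (eq_bigr (fun b => q l b * batch_grad f (W k s) b ord0 i));
      last by move=> b _; rewrite mxE.
    rewrite -(ind1 a _ l (fun b => batch_grad f (W k s) b ord0 i)); last first.
      by rewrite W_event//; exact: history_param.
    rewrite mulr_suml.
    transitivity (\sum_(t | a t) p t * batch_grad f (W k t) (xi l j (rep t)) ord0 i).
      by apply: eq_bigr => t /eqP ->.
    transitivity (\sum_(t | a t) p t * grad F (W k t) ord0 i); last first.
      by apply: eq_bigr => t /eqP ->.
    apply: (cond_exp_law mu h h_rv (sigma_param (w k))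
      (fun t => batch_grad f (W k t) (xi l j (rep t)) ord0 i)
      (fun t => grad F (W k t) ord0 i)); last first.
      by rewrite W_event//; exact: sigma_param_event.
    have <- : (fun o => batch_grad f (w k o) (xi l j o) ord0 i) =
        (fun o => batch_grad f (W k (h o)) (xi l j (rep (h o))) ord0 i).
      by apply/funext => o; rewrite (WE o k kj) XE.
    have <- : (fun o => grad F (w k o) ord0 i) = (fun o => grad F (W k (h o)) ord0 i).
      by apply/funext => o; rewrite (WE o k kj).
    exact: (xi_mean j l k jJ kj i).
  have var s l : 0 < \sum_(t | key t == key s) p t ->
      \sum_b q l b * dot (batch_grad f (r l s) b - grad F (r l s))
        (batch_grad f (r l s) b - grad F (r l s))
      <= sigma ^+ 2 / m%:R + M_G / m%:R * dot (grad F (r l s)) (grad F (r l s)).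
    move=> s_pos; have kj := tau_le l (rep s).
    have := lt_le_trans s_pos (W_ge _ s kj).
    rewrite /r; set k := tau l j (rep s) in kj *; set a := fun t => W k t == W k s.
    move=> a_pos; rewrite -(ler_pM2l a_pos).
    rewrite -(ind1 a _ l (fun b => dot (batch_grad f (W k s) b - grad F (W k s))
      (batch_grad f (W k s) b - grad F (W k s)))); last first.
      by rewrite W_event//; exact: history_param.
    rewrite mulr_suml.
    apply: (@le_trans _ _ (\sum_(t | a t) p t *
        l2norm (batch_grad f (W k t) (xi l j (rep t)) - grad F (W k t)) ^+ 2)).
      by apply: ler_sum => t /eqP ->; rewrite l2norm_sqr.
    apply: (@le_trans _ _ (\sum_(t | a t) p t *
        (sigma ^+ 2 / m%:R + M_G / m%:R * l2norm (grad F (W k t)) ^+ 2))); last first.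
      by apply: ler_sum => t /eqP ->; rewrite l2norm_sqr.
    apply: (cond_exp_le_law mu h h_rv (sigma_param (w k))
      (fun t => l2norm (batch_grad f (W k t) (xi l j (rep t)) - grad F (W k t)) ^+ 2)
      (fun t => sigma ^+ 2 / m%:R + M_G / m%:R * l2norm (grad F (W k t)) ^+ 2));
      last by rewrite W_event//; exact: sigma_param_event.
    have <- : (fun o => l2norm (batch_grad f (w k o) (xi l j o) - grad F (w k o)) ^+ 2)
        = (fun o => l2norm (batch_grad f (W k (h o)) (xi l j (rep (h o)))
            - grad F (W k (h o))) ^+ 2).
      by apply/funext => o; rewrite (WE o k kj) XE.
    have <- : (fun o => sigma ^+ 2 / m%:R + M_G / m%:R * l2norm (grad F (w k o)) ^+ 2)
        = (fun o => sigma ^+ 2 / m%:R + M_G / m%:R * l2norm (grad F (W k (h o))) ^+ 2).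
      by apply/funext => o; rewrite (WE o k kj).
    exact: (xi_var j l k jJ kj).
  have stale_le l :
      \sum_t p t * dot (grad F (v t) - grad F (r l t)) (grad F (v t) - grad F (r l t))
      <= gamma * n j.
    have := stale j l jJ; rewrite EE// -EFinM.
    rewrite -lee_fin; apply: le_trans; rewrite le_eqVlt; apply/orP; left; apply/eqP.
    rewrite -(expectation_law mu h h_rv (fun t =>
      dot (grad F (v t) - grad F (r l t)) (grad F (v t) - grad F (r l t)))).
    congr ('E_mu[_])%E; apply/funext => o.
    by rewrite l2norm_sqr /v /r tE (WE o j (leqnn j)) (WE o _ (tau_le l o)).
  have fresh_ge l : p0 * n j <= \sum_t p t * dot (grad F (r l t)) (grad F (r l t)).
    (* Only outcomes with an up-to-date gradient are kept, where [r l] and [v] agree; conditioning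
       on the value of [w j] brings in [p0]. *)
    apply: (@le_trans _ _ (\sum_(t | tau l j (rep t) == j)
        p t * dot (grad F (v t)) (grad F (v t)))).
      apply: (ler_sum_event p v _ p0 (fun t => dot (grad F (v t)) (grad F (v t))))
        => [s|s t /= -> //|t]; last exact: dot_ge0.
      apply: (cond_prob_ge_law mu h h_rv (history w tau j j)).
        have <- : [set o | tau l j o = j] = [set o | tau l j (rep (h o)) == j].
          by apply/seteqP; split => x /=; rewrite tE => /eqP.
        exact: fresh.
      by rewrite W_event//; exact: history_param.
    rewrite big_mkcond; apply: ler_sum => t _; case: ifPn => [/eqP tj|_].
      by rewrite /r tj.
    by rewrite mulr_ge0// dot_ge0.
  rewrite [e j.+1](_ : _ = \sum_t p t *
      F (v t - (eta / K%:R) *: \sum_l batch_grad f (r l t) (y t l))); last first.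
    apply: eq_bigr => t _; rewrite W_S; congr (_ * F (_ - _ *: _)).
    by apply: eq_bigr => l _; rewrite ffunE.
  apply: (async_one_step p F L (sigma ^+ 2 / m%:R) (M_G / m%:R) eta gamma p0
    (fun u b => batch_grad f u b) v r y q key) => //.
  - by move=> l b; exact: sumr_ge0.
  - by move=> s b; exact: ind.
  - by move=> s t st; exact: key_W.
  - by move=> l s t st; rewrite /r (key_tau _ _ l st); exact: key_W.
  - apply: le_trans eta_le; rewrite le_eqVlt natrM; apply/orP; left; apply/eqP.
    by field; rewrite !gt_eqF// ltr0n.
(* Telescoping of the one-step bounds. *)
have sum_le k : (k <= J)%N -> eta / 2 * gamma' * \sum_(0 <= j < k) n j <=
    e 0%N - e k + k%:R * (L * eta ^+ 2 * (sigma ^+ 2 / m%:R) / (2 * K%:R)).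
  elim: k => [|k IH] kJ; first by rewrite big_geq// mulr0 mul0r subrr addr0.
  rewrite big_nat_recr//= mulrDr -[k.+1%:R]natr1.
  by have := lerD (IH (ltnW kJ)) (step k kJ); lra.
have e0 : e 0%N = F w0.
  rewrite -[RHS]mul1r -p_sum1 mulr_suml.
  by apply: eq_bigr => t _; rewrite /W w_0.
have eJ : Fstar <= e J.
  rewrite -[leLHS]mul1r -p_sum1 mulr_suml; apply: ler_sum => t _.
  by rewrite ler_wpM2l// Fmin.2.
under eq_big_nat => j /andP[_ jJ] do rewrite EE//.
rewrite sumEFin -EFinM lee_fin.
have J_pos : 0 < J%:R :> R by rewrite ltr0n.
have K_pos : 0 < K%:R :> R by rewrite ltr0n.
have m_pos : 0 < m%:R :> R by rewrite ltr0n.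
have := sum_le J (leqnn J); rewrite e0 => le_S.
rewrite ler_pdivrMl//.
(* Multiplied by [eta / 2 * gamma'], the goal becomes the telescoped bound with [e J] replaced by
   its lower bound [Fstar]. *)
have c_pos : 0 < eta / 2 * gamma' by rewrite mulr_gt0// divr_gt0.
rewrite -(ler_pM2l c_pos); apply: (le_trans le_S).
rewrite [leRHS](_ : _ = F w0 - Fstar
    + J%:R * (L * eta ^+ 2 * (sigma ^+ 2 / m%:R) / (2 * K%:R))); last first.
  by field; rewrite !gt_eqF.
by rewrite lerD2r lerD2l lerN2.
Qed.
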